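(* Let $\mathcal{M}$ be a small $n$-abelian category. A mono functor $M\in(\mathcal{M},\mathcal{G})$ is absolutely pure if and only if for every left $n$-exact sequence $X^0\to X^1\to\cdots\to X^n\to X^{n+1}$ in $\mathcal{M}$, the sequence $0\to M(X^0)\to M(X^1)\to M(X^2)$ of abelian groups is exact.
   Context: $\mathcal{G}$ is the category of abelian groups and $(\mathcal{M},\mathcal{G})$ the abelian category of additive covariant functors $\mathcal{M}\to\mathcal{G}$. A mono functor is a functor in $(\mathcal{M},\mathcal{G})$ sending monomorphisms of $\mathcal{M}$ to injective maps. If $F'\subseteq F$ is a subfunctor with $F,F'$ mono functors, $F'$ is a pure subfunctor if the quotient $F/F'$ is a mono functor. A mono functor $M$ is absolutely pure if whenever $M$ is a subfunctor of a mono functor $N$, it is a pure subfunctor of $N$. A complex $X^0\xrightarrow{d^0}\cdots\xrightarrow{d^n}X^{n+1}$ in $\mathcal{M}$ is left $n$-exact if for all $W\in\mathcal{M}$ the sequence $0\to\mathcal{M}(W,X^0)\to\cdots\to\mathcal{M}(W,X^n)\to\mathcal{M}(W,X^{n+1})$ is exact. An $n$-abelian category is an idempotent complete additive category in which every morphism has an $n$-kernel and an $n$-cokernel, and in which every monomorphism (resp. epimorphism) together with any of its $n$-cokernels (resp. $n$-kernels) forms an $n$-exact sequence. *)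

(* Defs.v *)
From HB Require Import structures.
From mathcomp Require Import all_boot all_algebra.
Set Implicit Arguments.
Unset Strict Implicit.
Unset Printing Implicit Defensive.
Import GRing.Theory.
Local Open Scope ring_scope.

Record preadd := PreAdd {
  obj : Type;
  Mor : obj -> obj -> zmodType;
  comp : forall X Y Z, Mor Y Z -> Mor X Y -> Mor X Z;
  idm : forall X, Mor X X;
  compA : forall X Y Z W (h : Mor Z W) (g : Mor Y Z) (f : Mor X Y),
      comp h (comp g f) = comp (comp h g) f;
  comp1m : forall X Y (f : Mor X Y), comp (idm Y) f = f;
  compm1 : forall X Y (f : Mor X Y), comp f (idm X) = f;
  compDl : forall X Y Z (g1 g2 : Mor Y Z) (f : Mor X Y),
      comp (g1 + g2) f = comp g1 f + comp g2 f;
  compDr : forall X Y Z (g : Mor Y Z) (f1 f2 : Mor X Y),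
      comp g (f1 + f2) = comp g f1 + comp g f2
}.
Arguments comp {p X Y Z}.
Arguments idm {p}.
Arguments Mor : clear implicits.
Arguments obj : clear implicits.

Section Cat.
Variable C : preadd.
Local Notation Mor := (Mor C).

Definition mono A B (f : Mor A B) :=
  forall W (g h : Mor W A), comp f g = comp f h -> g = h.
Definition epi A B (f : Mor A B) :=
  forall W (g h : Mor B W), comp g f = comp h f -> g = h.

Definition has_zero_object := exists Z : obj C, idm Z = 0.
Definition has_biproducts := forall X Y : obj C,
  exists (B : obj C) (p1 : Mor B X) (p2 : Mor B Y) (i1 : Mor X B) (i2 : Mor Y B),
    [/\ comp p1 i1 = idm X, comp p2 i2 = idm Y, comp p1 i2 = 0,
        comp p2 i1 = 0 & comp i1 p1 + comp i2 p2 = idm B].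
Definition additive_cat := has_zero_object /\ has_biproducts.

Definition idempotent_complete := forall (X : obj C) (e : Mor X X),
  comp e e = e ->
  exists (Y : obj C) (r : Mor X Y) (s : Mor Y X), comp s r = e /\ comp r s = idm Y.

(* A sequence X^0 -> X^1 -> ... -> X^{n+1} is given by X : nat -> obj and
   d i : X^i -> X^{i+1}; only the indices 0 <= i <= n are relevant. *)
Definition is_complex n (X : nat -> obj C) (d : forall i, Mor (X i) (X i.+1)) :=
  forall i, (i < n)%N -> comp (d i.+1) (d i) = 0.

(* left n-exact: 0 -> M(W,X^0) -> ... -> M(W,X^n) -> M(W,X^{n+1}) exact for all W,
   i.e. (d^0,...,d^{n-1}) is an n-kernel of d^n *)
Definition left_n_exact n (X : nat -> obj C) (d : forall i, Mor (X i) (X i.+1)) :=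
  [/\ is_complex n d,
      (forall W (g : Mor W (X 0%N)), comp (d 0%N) g = 0 -> g = 0) &
      (forall W i, (i < n)%N -> forall g : Mor W (X i.+1),
          comp (d i.+1) g = 0 -> exists h : Mor W (X i), comp (d i) h = g)].

(* right n-exact: 0 -> M(X^{n+1},W) -> ... -> M(X^1,W) -> M(X^0,W) exact for all W,
   i.e. (d^1,...,d^n) is an n-cokernel of d^0 *)
Definition right_n_exact n (X : nat -> obj C) (d : forall i, Mor (X i) (X i.+1)) :=
  [/\ is_complex n d,
      (forall W (g : Mor (X n.+1) W), comp g (d n) = 0 -> g = 0) &
      (forall W i, (i < n)%N -> forall g : Mor (X i.+1) W,
          comp g (d i) = 0 -> exists h : Mor (X i.+2) W, comp h (d i.+1) = g)].

Definition n_exact n (X : nat -> obj C) (d : forall i, Mor (X i) (X i.+1)) :=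
  left_n_exact n d /\ right_n_exact n d.

(* f : A -> B has an n-kernel: a sequence X^0 -> ... -> X^n = A -> X^{n+1} = B
   with last map f that is left n-exact. *)
Definition has_n_kernel n A B (f : Mor A B) :=
  exists (X : nat -> obj C) (d : forall i, Mor (X i) (X i.+1)),
    existT (fun p : obj C * obj C => Mor p.1 p.2) (X n, X n.+1) (d n)
      = existT (fun p : obj C * obj C => Mor p.1 p.2) (A, B) f
    /\ left_n_exact n d.

Definition has_n_cokernel n A B (f : Mor A B) :=
  exists (X : nat -> obj C) (d : forall i, Mor (X i) (X i.+1)),
    existT (fun p : obj C * obj C => Mor p.1 p.2) (X 0%N, X 1%N) (d 0%N)
      = existT (fun p : obj C * obj C => Mor p.1 p.2) (A, B) f
    /\ right_n_exact n d.

Definition n_abelian n :=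
  [/\ additive_cat, idempotent_complete,
      (forall A B (f : Mor A B), has_n_kernel n f /\ has_n_cokernel n f),
      (forall (X : nat -> obj C) (d : forall i, Mor (X i) (X i.+1)),
          mono (d 0%N) -> right_n_exact n d -> n_exact n d) &
      (forall (X : nat -> obj C) (d : forall i, Mor (X i) (X i.+1)),
          epi (d n) -> left_n_exact n d -> n_exact n d)].

End Cat.

Record afunctor (C : preadd) := AFunctor {
  fobj : obj C -> zmodType;
  fmap : forall X Y, Mor C X Y -> fobj X -> fobj Y;
  fmapD : forall X Y (f : Mor C X Y) (a b : fobj X),
      fmap f (a + b) = fmap f a + fmap f b;
  fmap1 : forall X (a : fobj X), fmap (idm X) a = a;
  fmapM : forall X Y Z (g : Mor C Y Z) (f : Mor C X Y) (a : fobj X),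
      fmap (comp g f) a = fmap g (fmap f a);
  fmapDf : forall X Y (f g : Mor C X Y) (a : fobj X),
      fmap (f + g) a = fmap f a + fmap g a
}.
Arguments fobj {C}.
Arguments fmap {C} _ {X Y}.

Section Fun.
Variable C : preadd.

Definition mono_functor (M : afunctor C) :=
  forall X Y (f : Mor C X Y), mono f -> injective (fmap M f).

(* M is (identified with) a subfunctor of N via a pointwise injective
   natural transformation a : M -> N. *)
Definition subfunctor_emb (M N : afunctor C) (a : forall X, fobj M X -> fobj N X) :=
  [/\ (forall X (x y : fobj M X), a X (x + y) = a X x + a X y),
      (forall X, injective (a X)) &
      (forall X Y (f : Mor C X Y) (x : fobj M X), fmap N f (a X x) = a Y (fmap M f x))].

(* the quotient functor N/M is a mono functor: (N/M)(f)[y] = [N(f) y] is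
   injective for every monomorphism f, i.e. N(f) y in M(Y) implies y in M(X). *)
Definition quotient_mono (M N : afunctor C) (a : forall X, fobj M X -> fobj N X) :=
  forall X Y (f : Mor C X Y), mono f -> forall y : fobj N X,
    (exists m : fobj M Y, a Y m = fmap N f y) -> exists m' : fobj M X, a X m' = y.

Definition pure_subfunctor (M N : afunctor C) (a : forall X, fobj M X -> fobj N X) :=
  [/\ mono_functor M, mono_functor N, subfunctor_emb a & quotient_mono a].

Definition absolutely_pure (M : afunctor C) :=
  mono_functor M /\
  forall (N : afunctor C) (a : forall X, fobj M X -> fobj N X),
    mono_functor N -> subfunctor_emb a -> pure_subfunctor a.

End Fun.

(* Main.v *)
(** If M is exact on left n-exact sequences, purity of M in N follows by applying M to an n-cokernel
    of the given monomorphism.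

    Conversely, let y in M(X1) satisfy M(d1) y = 0.  Glue to M a generic preimage of y along d0, i.e.
    form the pushout of Hom(X1, -) -> Hom(X0, -) and y : Hom(X1, -) -> M, and divide by the elements
    killed by some monomorphism.  Pushouts of monomorphisms are monomorphisms, so those elements form
    a subfunctor and the quotient N is a mono functor.  The map M -> N is injective as soon as
    M(g) y = 0 for every g with g d0 = 0.  Such a g factors through the first map c : X1 -> Y2 of an
    n-cokernel of d0.  Write d1 = u c.  If n > 1 then u is jointly monic with the next map Y2 -> Y3,
    which kills c; if n = 1 then u itself is monic, because c is an epimorphism and epimorphisms are
    stable under pullback.  Either way M(d1) y = 0 forces M(c) y = 0.  Purity of M in N then yields a
    preimage of y in M(X0). *)

Require Import Defs.
From HB Require Import structures.
From mathcomp Require Import all_boot all_algebra.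
From mathcomp Require Import boolp.
Import Defs GRing.Theory.
Local Open Scope ring_scope.

Set Implicit Arguments.
Unset Strict Implicit.

(** * Elementary facts on preadditive categories and additive functors *)

Section Preadditive.
Variable C : preadd.

Lemma comp0m X Y Z (f : Mor C X Y) : comp (0 : Mor C Y Z) f = 0.
Proof. by apply: (addrI (comp 0 f)); rewrite -compDl !addr0. Qed.

Lemma compm0 X Y Z (g : Mor C Y Z) : comp g (0 : Mor C X Y) = 0.
Proof. by apply: (addrI (comp g 0)); rewrite -compDr !addr0. Qed.

Lemma compNm X Y Z (g : Mor C Y Z) (f : Mor C X Y) : comp (- g) f = - comp g f.
Proof. by apply: (addrI (comp g f)); rewrite -compDl !subrr comp0m. Qed.

Lemma compmN X Y Z (g : Mor C Y Z) (f : Mor C X Y) : comp g (- f) = - comp g f.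
Proof. by apply: (addrI (comp g f)); rewrite -compDr !subrr compm0. Qed.

Lemma mono0P X Y (f : Mor C X Y) :
  mono f <-> forall W (g : Mor C W X), comp f g = 0 -> g = 0.
Proof.
split=> [mf W g fg0|f0 W g h fgh]; first by apply: mf; rewrite fg0 compm0.
by apply/eqP; rewrite -subr_eq0; apply/eqP/f0; rewrite compDr compmN fgh subrr.
Qed.

Lemma epi0P X Y (f : Mor C X Y) :
  epi f <-> forall W (g : Mor C Y W), comp g f = 0 -> g = 0.
Proof.
split=> [ef W g gf0|f0 W g h gfh]; first by apply: ef; rewrite gf0 comp0m.
by apply/eqP; rewrite -subr_eq0; apply/eqP/f0; rewrite compDl compNm gfh subrr.
Qed.

Lemma mono_idm X : mono (@idm C X).
Proof. by move=> W g h; rewrite !comp1m. Qed.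

Lemma mono_comp X Y Z (g : Mor C Y Z) (f : Mor C X Y) : mono g -> mono f -> mono (comp g f).
Proof. by move=> mg mf W a b; rewrite -!compA => /mg/mf. Qed.

End Preadditive.

Section FunctorLaws.
Variables (C : preadd) (M : afunctor C).

Lemma fmapx0 X Y (f : Mor C X Y) : fmap M f 0 = 0.
Proof. by apply: (addrI (fmap M f 0)); rewrite -fmapD !addr0. Qed.

Lemma fmap0 X Y (x : fobj M X) : fmap M (0 : Mor C X Y) x = 0.
Proof. by apply: (addrI (fmap M (0 : Mor C X Y) x)); rewrite -fmapDf !addr0. Qed.

Lemma fmapN X Y (f : Mor C X Y) (x : fobj M X) : fmap M f (- x) = - fmap M f x.
Proof. by apply: (addrI (fmap M f x)); rewrite -fmapD !subrr fmapx0. Qed.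

Lemma fmapNf X Y (f : Mor C X Y) (x : fobj M X) : fmap M (- f) x = - fmap M f x.
Proof. by apply: (addrI (fmap M f x)); rewrite -fmapDf !subrr fmap0. Qed.

Lemma mono_functor0 (HM : mono_functor M) X Y (f : Mor C X Y) (x : fobj M X) :
  mono f -> fmap M f x = 0 -> x = 0.
Proof. by move=> mf fx0; apply: (HM _ _ _ mf); rewrite fx0 fmapx0. Qed.

End FunctorLaws.

(** * Pushouts, pullbacks and cokernels in an n-abelian category *)

Section NAbelian.
Variables (n : nat) (C : preadd).
Hypotheses (hn : (0 < n)%N) (HC : n_abelian C n).

(* These two inductions replace an arbitrary morphism by a term of an n-exact sequence, which avoids
   transporting along the equality of packed morphisms in has_n_cokernel and has_n_kernel. *)
Lemma mono_n_exact_ind (P : forall A B, Mor C A B -> Prop) :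
  (forall X d, @n_exact C n X d -> P _ _ (d 0%N)) -> forall A B (f : Mor C A B), mono f -> P A B f.
Proof.
case: HC => _ _ HK Hmono _ PX A B f mf.
have [X [d [E rd]]] := (HK A B f).2.
pose Q (s : {p : obj C * obj C & Mor C p.1 p.2}) := mono (projT2 s) -> P _ _ (projT2 s).
suff: Q (existT (fun p : obj C * obj C => Mor C p.1 p.2) (A, B) f) by exact.
by rewrite -E => md; apply: PX; apply: Hmono.
Qed.

Lemma epi_n_exact_ind (P : forall A B, Mor C A B -> Prop) :
  (forall X d, @n_exact C n X d -> P _ _ (d n)) -> forall A B (f : Mor C A B), epi f -> P A B f.
Proof.
case: HC => _ _ HK _ Hepi PX A B f ef.
have [X [d [E ld]]] := (HK A B f).1.
pose Q (s : {p : obj C * obj C & Mor C p.1 p.2}) := epi (projT2 s) -> P _ _ (projT2 s).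
suff: Q (existT (fun p : obj C * obj C => Mor C p.1 p.2) (A, B) f) by exact.
by rewrite -E => ed; apply: PX; apply: Hepi.
Qed.

(** An n-cokernel completes [f] to an n-exact sequence, whose left exactness makes [f] a kernel of
    the next map. *)
Lemma mono_weak_cokernel A B (f : Mor C A B) : mono f ->
  exists D (c : Mor C B D),
    comp c f = 0 /\ forall T (t : Mor C T B), comp c t = 0 -> exists s, comp f s = t.
Proof.
move: A B f; apply: mono_n_exact_ind => X d [[cd _ ed] _].
by exists (X 2), (d 1%N); split=> [|T t]; [apply: cd | apply: ed].
Qed.

Lemma epi_weak_kernel A B (f : Mor C A B) : epi f ->
  exists K (k : Mor C K A),
    comp f k = 0 /\ forall T (t : Mor C A T), comp t k = 0 -> exists s, comp s f = t.
Proof.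
move: A B f; apply: epi_n_exact_ind => X d [_ [cd _ ed]].
(* The map before the last one has index [n - 1], so [n] is first written as a successor. *)
case: n hn X d cd ed => // m _ X d cd ed.
by exists (X m), (d m); split=> [|T t]; [apply: cd | apply: ed].
Qed.

(** Every map killed by [c] factors through [f], whose components are [h] and [- j]. If
    [c i1 t = 0], then [i1 t = f s], and the component in [V] gives [j s = 0], hence [s = 0] and
    [t = 0]. *)
Lemma mono_pushout W V W' (j : Mor C W V) (h : Mor C W W') : mono j ->
  exists V' (k : Mor C W' V') (l : Mor C V V'), mono k /\ comp k h = comp l j.
Proof.
move=> mj; have [[_ biprod] _ _ _ _] := HC.
have [B [p1 [p2 [i1 [i2 [p1i1 p2i2 p1i2 p2i1 _]]]]]] := biprod W' V.
pose f := comp i1 h - comp i2 j.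
have p2f : comp p2 f = - j.
  by rewrite compDr compmN !compA p2i1 p2i2 comp0m comp1m add0r.
have mf : mono f.
  apply/mono0P => T t ft0; apply: (mono0P j).1 mj _ _ _.
  by rewrite -[j]opprK -p2f compNm -compA ft0 compm0 oppr0.
have [D [c [cf0 kerc]]] := mono_weak_cokernel mf.
exists D, (comp c i1), (comp c i2); split; last first.
  by apply/eqP; rewrite -subr_eq0 -!compA -compmN -compDr; apply/eqP.
apply/mono0P => T t; rewrite -compA => /kerc [s fs].
have s0 : s = 0.
  apply: (mono0P j).1 mj _ _ _.
  by rewrite -[j]opprK -p2f compNm -compA fs compA p2i1 comp0m oppr0.
by rewrite -[t]comp1m -p1i1 -compA -fs s0 !compm0.
Qed.

Lemma epi_pullback V W W' (c : Mor C V W) (t : Mor C W' W) : epi c ->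
  exists V' (p : Mor C V' W') (s : Mor C V' V), epi p /\ comp t p = comp c s.
Proof.
move=> ec; have [[_ biprod] _ _ _ _] := HC.
have [B [p1 [p2 [i1 [i2 [p1i1 p2i2 p1i2 p2i1 _]]]]]] := biprod W' V.
pose f := comp t p1 - comp c p2.
have fi2 : comp f i2 = - c.
  by rewrite compDl compNm -!compA p1i2 p2i2 compm0 compm1 add0r.
have ef : epi f.
  apply/epi0P => T u uf0; apply: (epi0P c).1 ec _ _ _.
  by rewrite -[c]opprK -fi2 compmN compA uf0 comp0m oppr0.
have [K [k [fk0 cokk]]] := epi_weak_kernel ef.
exists K, (comp p1 k), (comp p2 k); split; last first.
  by apply/eqP; rewrite -subr_eq0 !compA -compNm -compDl; apply/eqP.
apply/epi0P => T u; rewrite compA => /cokk [s sf].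
have s0 : s = 0.
  apply: (epi0P c).1 ec _ _ _.
  by rewrite -[c]opprK -fi2 compmN compA sf -compA p1i2 compm0 oppr0.
by rewrite -[u]compm1 -p1i1 compA -sf s0 !comp0m.
Qed.

Lemma mono_functor_weak_cokernel (M : afunctor C) (HM : mono_functor M)
    A B E (f : Mor C A B) (d : Mor C B E) (y : fobj M B) :
  mono f -> comp d f = 0 ->
  (forall T (t : Mor C T B), comp d t = 0 -> exists s, comp f s = t) ->
  fmap M d y = 0 -> forall W (g : Mor C B W), comp g f = 0 -> fmap M g y = 0.
Proof.
move=> mf; move: A B f mf d y; apply: mono_n_exact_ind => X e [[ce _ le] [_ re re']] d y.
move=> df kerd dy0 W g gf.
have [u uc] := re' _ 0%N hn _ df; have [h <-] := re' _ 0%N hn _ gf.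
suff cy0 : fmap M (e 1%N) y = 0 by rewrite fmapM cy0 fmapx0.
have [n1|n2] := leqP n 1.
  have mu : mono u.
    apply/mono0P => T t ut0.
    have n1E : n = 1%N by apply/eqP; rewrite eqn_leq n1 hn.
    have ec : epi (e 1%N) by apply/epi0P; rewrite n1E in re.
    (* After composition with the epimorphism [p], the map [t] lifts along [e 1] to [s]. Since
       [d s = u t p = 0], [s] factors through [e 0], so [t p = 0]. *)
    have [V [p [s [ep tp]]]] := epi_pullback t ec.
    apply: (epi0P p).1 ep _ _ _.
    have [r fr] : exists r, comp (e 0%N) r = s.
      by apply: kerd; rewrite -uc -compA -tp compA ut0 comp0m.
    by rewrite tp -fr compA ce // comp0m.
  by apply: (mono_functor0 HM mu); rewrite -fmapM uc.
have [[_ biprod] _ _ _ _] := HC.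
have [Z [p1 [p2 [i1 [i2 [p1i1 p2i2 p1i2 p2i1 _]]]]]] := biprod E (X 3).
pose v := comp i1 u + comp i2 (e 2).
have p1v : comp p1 v = u.
  by rewrite compDr !compA p1i1 p1i2 comp1m comp0m addr0.
have p2v : comp p2 v = e 2.
  by rewrite compDr !compA p2i1 p2i2 comp1m comp0m add0r.
(* Here [e 2] is a map of the sequence, so [e 2 t = 0] lifts [t] itself along [e 1]. *)
have mv : mono v.
  apply/mono0P => T t vt0.
  have ut0 : comp u t = 0 by rewrite -p1v -compA vt0 compm0.
  have [r er] : exists r, comp (e 1%N) r = t.
    by apply: le => //; rewrite -p2v -compA vt0 compm0.
  have [s fs] : exists s, comp (e 0%N) s = r.
    by apply: kerd; rewrite -uc -compA er.
  by rewrite -er -fs compA ce // comp0m.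
apply: (mono_functor0 HM mv); rewrite -fmapM compDl -!compA uc ce // compm0 addr0.
by rewrite fmapM dy0 fmapx0.
Qed.

End NAbelian.

(** * Quotient of an additive functor by a subfunctor *)

Section QuotientFunctor.
Variables (C : preadd) (F : afunctor C) (P : forall X, fobj F X -> Prop).
Hypotheses (P0 : forall X, P (0 : fobj F X))
  (PB : forall X (x y : fobj F X), P x -> P y -> P (x - y))
  (Pf : forall X Y (f : Mor C X Y) (x : fobj F X), P x -> P (fmap F f x)).

(** The classical truth value makes [P] a Boolean predicate, as the quotient group construction
    requires. *)
Definition subgroup X : {pred fobj F X} := fun x => `[< P x >].

Lemma subgroup_zmod_closed X : zmod_closed (@subgroup X).
Proof. by split=> [|x y /asboolP Px /asboolP Py]; apply/asboolP; [apply: P0 | apply: PB]. Qed.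

HB.instance Definition _ X :=
  GRing.isZmodClosed.Build (fobj F X) (@subgroup X) (@subgroup_zmod_closed X).

Definition quotient_obj X : zmodType := Quotient.quot (@subgroup X).
Definition quotient_pi X : fobj F X -> quotient_obj X := \pi_(quotient_obj X)%qT.
Definition quotient_map X Y (f : Mor C X Y) (q : quotient_obj X) : quotient_obj Y :=
  quotient_pi (fmap F f (repr q)).

Lemma quotient_piP X (x y : fobj F X) : quotient_pi x = quotient_pi y <-> P (x - y).
Proof.
split=> [/eqP|Pxy]; first by rewrite -Quotient.idealrBE => /asboolP.
by apply/eqP; rewrite -Quotient.idealrBE; apply/asboolP.
Qed.

Lemma quotient_piD X (x y : fobj F X) : quotient_pi (x + y) = quotient_pi x + quotient_pi y.
Proof. exact: raddfD. Qed.

Lemma quotient_pi_surj X (q : quotient_obj X) : exists x, q = quotient_pi x.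
Proof. by exists (repr q); rewrite /quotient_pi reprK. Qed.

Lemma quotient_map_pi X Y (f : Mor C X Y) (x : fobj F X) :
  quotient_map f (quotient_pi x) = quotient_pi (fmap F f x).
Proof.
apply/quotient_piP; rewrite -fmapN -fmapD; apply: Pf; apply/quotient_piP.
by rewrite /quotient_pi reprK.
Qed.

Definition quotient_functor : afunctor C.
Proof.
apply: (@AFunctor C quotient_obj quotient_map).
- move=> X Y f a b; have [x ->] := quotient_pi_surj a; have [y ->] := quotient_pi_surj b.
  by rewrite -quotient_piD !quotient_map_pi fmapD quotient_piD.
- by move=> X a; have [x ->] := quotient_pi_surj a; rewrite quotient_map_pi fmap1.
- by move=> X Y Z g f a; have [x ->] := quotient_pi_surj a; rewrite !quotient_map_pi fmapM.
- move=> X Y f g a; have [x ->] := quotient_pi_surj a.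
  by rewrite !quotient_map_pi fmapDf quotient_piD.
Defined.

End QuotientFunctor.

(** * Extension of [M] by a generic preimage of [y] *)

Section AdjoinElement.
Variables (C : preadd) (M : afunctor C) (A : obj C).

(** This is the direct sum of [M] and [Hom(A, -)]; by Yoneda, [(0, idm A)] is the generic element
    adjoined. *)
Definition adjoin_hom : afunctor C.
Proof.
apply: (@AFunctor C (fun W => (fobj M W * Mor C A W)%type : zmodType)
          (fun V W h x => (fmap M h x.1, comp h x.2))).
- by move=> X Y f a b; rewrite fmapD compDr.
- by move=> X [a1 a2]; rewrite fmap1 comp1m.
- by move=> X Y Z g f a; rewrite fmapM compA.
- by move=> X Y f g a; rewrite fmapDf compDl.
Defined.

End AdjoinElement.

Section AdjoinPreimage.
Variables (n : nat) (C : preadd) (M : afunctor C).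
Hypotheses (hn : (0 < n)%N) (HC : n_abelian C n) (HM : mono_functor M).
Variables (A B : obj C) (f : Mor C A B) (y : fobj M B).

Local Notation F := (adjoin_hom M A).

(* The relations (M(g) y, - g f) identify the image under f of the generic element with y; allowing
   a monomorphism j in front adds the torsion of the quotient. *)
Definition glue W (x : fobj F W) : Prop :=
  exists V (j : Mor C W V) (g : Mor C B V),
    mono j /\ fmap F j x = (fmap M g y, - comp g f).

Lemma glue0 W : glue (0 : fobj F W).
Proof.
exists W, (idm W), 0; split; first exact: mono_idm.
by rewrite fmap1 fmap0 comp0m oppr0.
Qed.

(** Pushing [j] out along [h] gives a monomorphism [k] that carries [h x] to the relation of
    [l g]. *)
Lemma glue_fmap W W' (h : Mor C W W') (x : fobj F W) : glue x -> glue (fmap F h x).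
Proof.
move=> [V [j [g [mj jx]]]]; have [V' [k [l [mk kl]]]] := mono_pushout hn HC h mj.
exists V', k, (comp l g); split=> //.
by rewrite -fmapM kl fmapM jx /= fmapM compmN compA.
Qed.

Lemma glue_mono W W' (i : Mor C W W') (x : fobj F W) : mono i -> glue (fmap F i x) -> glue x.
Proof.
move=> mi [V [j [g [mj jx]]]]; exists V, (comp j i), g; split; first exact: mono_comp.
by rewrite fmapM.
Qed.

Lemma glueB W (x x' : fobj F W) : glue x -> glue x' -> glue (x - x').
Proof.
move=> [V [j [g [mj jx]]]] [V' [j' [g' [mj' jx']]]].
(* The pushout brings both relations behind the single monomorphism [k j = l j']. *)
have [V2 [k [l [mk kl]]]] := mono_pushout hn HC j mj'.
exists V2, (comp k j), (comp k g - comp l g'); split; first exact: mono_comp.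
rewrite fmapD fmapN {2}kl !fmapM jx jx' /= fmapDf fmapNf !fmapM.
by rewrite compDl compNm !compmN -!compA opprD.
Qed.

Definition adjoin_preimage : afunctor C := quotient_functor glue0 glueB glue_fmap.

Definition adjoin_preimage_pi W (x : fobj F W) : fobj adjoin_preimage W :=
  quotient_pi glue0 glueB x.

Lemma adjoin_preimage_piP W (x x' : fobj F W) :
  adjoin_preimage_pi x = adjoin_preimage_pi x' <-> glue (x - x').
Proof. exact: quotient_piP. Qed.

Lemma adjoin_preimage_fmap W W' (h : Mor C W W') (x : fobj F W) :
  fmap adjoin_preimage h (adjoin_preimage_pi x) = adjoin_preimage_pi (fmap F h x).
Proof. exact: (quotient_map_pi glue0 glueB glue_fmap). Qed.

Definition adjoin_preimage_emb W (m : fobj M W) : fobj adjoin_preimage W :=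
  adjoin_preimage_pi ((m, 0) : fobj F W).

Lemma adjoin_preimage_mono : mono_functor adjoin_preimage.
Proof.
move=> X Y i mi a b.
have [x ->] := quotient_pi_surj a; have [x' ->] := quotient_pi_surj b.
rewrite !adjoin_preimage_fmap => /adjoin_preimage_piP.
rewrite -fmapN -fmapD => /(glue_mono mi) xx'.
exact/adjoin_preimage_piP.
Qed.

Lemma adjoin_preimage_subfunctor :
  (forall W (g : Mor C B W), comp g f = 0 -> fmap M g y = 0) ->
  subfunctor_emb adjoin_preimage_emb.
Proof.
move=> yK; split=> [X x x'|X x x'|X Y h x].
- rewrite /adjoin_preimage_emb /adjoin_preimage_pi -quotient_piD.
  by congr quotient_pi; congr pair; rewrite addr0.
- move=> /adjoin_preimage_piP [V [j [g [mj [jx gf]]]]].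
  apply/eqP; rewrite -subr_eq0; apply/eqP; apply: (mono_functor0 HM mj).
  (* The second component of the relation forces [g f = 0]. *)
  rewrite jx; apply: yK; apply/eqP; rewrite -oppr_eq0 -gf.
  by rewrite subrr compm0.
- by rewrite adjoin_preimage_fmap /= compm0.
Qed.

Lemma adjoin_preimageP :
  fmap adjoin_preimage f (adjoin_preimage_pi ((0, idm A) : fobj F A)) = adjoin_preimage_emb y.
Proof.
rewrite adjoin_preimage_fmap; apply/adjoin_preimage_piP.
(* The difference of the two elements is [(- y, f)], the relation of [g = - idm B]. *)
exists B, (idm B), (- idm B); split; first exact: mono_idm.
by rewrite fmap1 /= fmapx0 compm1 fmapNf fmap1 compNm comp1m opprK;
  congr pair; rewrite ?sub0r ?subr0.
Qed.

End AdjoinPreimage.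

Theorem theoremA (n : nat) (hn : (0 < n)%N) (C : preadd) (HC : n_abelian C n)
    (M : afunctor C) (HM : mono_functor M) :
  absolutely_pure M <->
  (forall (X : nat -> obj C) (d : forall i, Mor C (X i) (X i.+1)),
     left_n_exact n d ->
     injective (fmap M (d 0%N)) /\
     (forall y : fobj M (X 1%N),
        fmap M (d 1%N) y = 0 <-> exists x : fobj M (X 0%N), fmap M (d 0%N) x = y)).
Proof.
split=> [[_ pureM] X d [cd d0 ed]|exM].
  have md : mono (d 0%N) by apply/mono0P.
  split=> [|y]; first exact: HM.
  split=> [dy0|[x <-]]; last by rewrite -fmapM cd // fmap0.
  have yK := mono_functor_weak_cokernel hn HC HM md (cd _ hn) (fun T => ed T _ hn) dy0.
  have sub := adjoin_preimage_subfunctor hn HC HM yK.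
  have [_ _ _ quo] := pureM _ _ (@adjoin_preimage_mono _ _ _ hn HC _ _ (d 0%N) y) sub.
  (* The image of the generic element under [d 0] is [y], which lies in [M], so purity puts the
     generic element in [M]. *)
  have [|x ax] := quo _ _ _ md (adjoin_preimage_pi hn HC (d 0%N) y (0, idm _)).
    by exists y; rewrite adjoin_preimageP.
  case: sub => _ inja nat_a; exists x; apply: inja.
  by rewrite -nat_a ax adjoin_preimageP.
split=> // N a HN [aD inja nat_a]; split=> // X Y f mf.
move: X Y f mf; apply: (mono_n_exact_ind HC) => X d [ld rd] z [m am].
have [inj0 ex1] := exM X d ld; case: ld => cd d0 _.
have md : mono (d 0%N) by apply/mono0P.
have a0 W : a W 0 = 0 by apply: (addrI (a W 0)); rewrite -aD !addr0.
(* [a] sends [M(d 1) m] to [N(d 1) (N(d 0) z) = 0], so [m] comes from [M(X 0)]. *)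
have [|x dx] := (ex1 m).1.
  by apply: inja; rewrite -nat_a am -fmapM cd // fmap0 a0.
by exists x; apply: (HN _ _ _ md); rewrite nat_a dx.
Qed.
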